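(* Let $q\equiv 3 \pmod{4}$ be a prime power. Then $$\mathcal{K}_3(G_2(q)) = \frac{q(q-1)(q-3)}{2^3}.$$
   Context: $G_2(q)$ is the Paley tournament of order $q$: the digraph with vertex set the finite field $\mathbb{F}_q$ where $a \to b$ is an edge if and only if $b-a$ is a nonzero square in $\mathbb{F}_q$. For a digraph $G$, $\mathcal{K}_m(G)$ is the number of transitive subtournaments of order $m$ contained in $G$; a tournament of order $m$ is transitive if its vertices can be listed $a_1,\dots,a_m$ with $a_i \to a_j$ for all $i<j$. *)

(* Defs.v *)
From HB Require Import structures.
From mathcomp Require Import all_boot all_order all_algebra.

Set Implicit Arguments.
Unset Strict Implicit.
Unset Printing Implicit Defensive.

Import GRing.Theory.
Local Open Scope ring_scope.

Section Digraphs.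
Variable T : finType.

(* A digraph on the whole of T is a relation [G : rel T]; a finite digraph with
   its own vertex set is a pair [H] of a vertex set [H.1] and an arc set [H.2]. *)
Definition subdigraph (G : rel T) (H : {set T} * {set T * T}) : bool :=
  (H.2 \subset setX H.1 H.1) && [forall a in H.2, G a.1 a.2].

Definition is_tournament (H : {set T} * {set T * T}) : bool :=
  [forall x in H.1, (x, x) \notin H.2] &&
  [forall x in H.1, forall y in H.1,
     (x != y) ==> (((x, y) \in H.2) (+) ((y, x) \in H.2))].

Definition is_transitive (m : nat) (H : {set T} * {set T * T}) : bool :=
  [exists s : m.-tuple T,
    [&& uniq s, [set x in s] == H.1 &
        [forall i : 'I_m, forall j : 'I_m,
           (i < j)%N ==> ((tnth s i, tnth s j) \in H.2)]]].

(* Subtournaments are counted as subdigraphs, not as vertex sets; the two counts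
   agree when G has no pair of opposite arcs. *)
Definition transitive_subtournaments (m : nat) (G : rel T) :
    {set {set T} * {set T * T}} :=
  [set H : {set T} * {set T * T} |
     [&& #|H.1| == m, subdigraph G H, is_tournament H
       & is_transitive m H]].

Definition num_transitive (m : nat) (G : rel T) : nat :=
  #|transitive_subtournaments m G|.

End Digraphs.

Definition paley (F : finFieldType) : rel F :=
  fun a b => (b - a != 0) && [exists c : F, b - a == c ^+ 2].

(* Main.v *)
Require Import Defs.
From mathcomp Require Import all_boot all_order all_fingroup all_algebra.
From mathcomp Require Import all_solvable all_field.
From mathcomp Require Import ring zify.

Set Implicit Arguments.
Unset Strict Implicit.
Unset Printing Implicit Defensive.

Import GRing.Theory.
Local Open Scope ring_scope.

(** A transitive tournament on three vertices has exactly one source, and the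
    other two vertices are out-neighbours of it. Conversely, in a tournament any
    two out-neighbours of a vertex [v] are joined by exactly one arc, so that
    they form a transitive triple together with [v]. Hence a tournament contains
    [\sum_v 'C(d v, 2)] transitive triples, where [d v] is the out-degree of [v]
    ([num_transitive3]).

    For #|F| = 3 mod 4 write #|F| = 2m + 1 with [m] odd. A nonzero [x] satisfies
    [x ^+ m = 1] or [x ^+ m = -1], and it is a square exactly in the first case;
    as [m] is odd, exactly one of [x] and [- x] is a square
    ([paley_tournament]). The reflection [b |-> a + a - b] exchanges out- and
    in-neighbours of [a], so all out-degrees are equal to [m]
    ([paley_outdegree]), and the count is (2m + 1) * 'C(m, 2). *)

Section Tournaments.
Variables (T : finType) (G : rel T).

(** [G] is a tournament on the whole of [T]: no loops (the case [x = y]), and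
    exactly one arc between two distinct vertices. *)
Definition tournament : Prop := forall x y, G y x = (x != y) && ~~ G x y.

Hypothesis tourG : tournament.

Lemma tournament_irr x : G x x = false.
Proof. by rewrite tourG eqxx. Qed.

Lemma tournament_asym x y : G x y -> G y x = false.
Proof. by move=> Gxy; rewrite tourG Gxy andbF. Qed.

Lemma pairwise_uniq_tournament (s : seq T) : pairwise G s -> uniq s.
Proof.
elim: s => //= x s IHs /andP[/allP Gx /IHs ->]; rewrite andbT.
by apply/negP=> /Gx; rewrite tournament_irr.
Qed.

(** A transitive ordering of a set of vertices is unique, since its first vertex
    has to be the source. *)
Lemma pairwise_tournament_inj (s t : seq T) :
  pairwise G s -> pairwise G t -> s =i t -> s = t.
Proof.
elim: s t => [|x s IHs] [|y t] //= Gs Gt est.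
- by have := est y; rewrite inE eqxx.
- by have := est x; rewrite inE eqxx.
have /= /andP[xNs _] := @pairwise_uniq_tournament (x :: s) Gs.
have /= /andP[yNt _] := @pairwise_uniq_tournament (y :: t) Gt.
case/andP: Gs Gt => /allP Gx Gs /andP[/allP Gy Gt].
have exy : x = y.
  apply/eqP/negPn/negP=> nxy.
  have := est x; rewrite !inE eqxx (negPf nxy) /= => /esym/Gy Gyx.
  have := est y; rewrite !inE eqxx eq_sym (negPf nxy) /= => /Gx.
  by rewrite (tournament_asym Gyx).
subst y; congr cons; apply: IHs => // z.
have := est z; rewrite !inE; case: eqVneq => [->|//].
by rewrite (negPf xNs) (negPf yNt).
Qed.

(** The subdigraph of [G] induced on the vertex set [V]. *)
Definition induced (V : {set T}) : {set T} * {set T * T} :=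
  (V, [set e in setX V V | G e.1 e.2]).

(** A transitive subtournament of [G] contains every arc of [G] between two of
    its vertices, so it is the subdigraph induced on a transitively ordered tuple. *)
Lemma transitive_subtournamentsE m :
  transitive_subtournaments m G =
    [set induced [set x in s] | s : m.-tuple T in
      [set s : m.-tuple T | pairwise G s]].
Proof.
apply/setP=> -[V A]; rewrite inE; apply/idP/imsetP.
- case/and4P=> /= _ /andP[/= /subsetP AV /forall_inP AG] /andP[_ /= Atour].
  case/existsP=> s /and3P[/= _ /eqP eV /forallP As].
  exists s.
    rewrite inE; case: m s eV As => [|m] s eV As; first by rewrite tuple0.
    apply/(pairwiseP (thead s)) => i j; rewrite !inE size_tuple => im jm ij.
    have /forallP/(_ (Ordinal jm)) /= := As (Ordinal im).
    by rewrite ij !(tnth_nth (thead s)) => /AG.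
  congr (_, _); first by rewrite eV.
  rewrite eV; apply/setP=> -[x y]; rewrite !inE /=; apply/idP/idP.
    by move=> Axy; have := AV _ Axy; rewrite inE /= => ->; apply: AG Axy.
  case/andP=> /andP[xV yV] Gxy.
  (* [x] and [y] are joined by an arc of [A], which cannot be [(y, x)]. *)
  have nxy : x != y by apply: contraTneq Gxy => ->; rewrite tournament_irr.
  have /forall_inP/(_ y yV) := forall_inP Atour x xV.
  rewrite nxy /=; case: (boolP ((y, x) \in A)) => [/AG /=|_].
    by rewrite (tournament_asym Gxy).
  by rewrite addbF.
- case=> s; rewrite inE => Gs [-> ->].
  have us := pairwise_uniq_tournament Gs.
  apply/and4P; split=> /=.
  + by rewrite cardsE (card_uniqP us) size_tuple.
  + apply/andP; split=> /=; first by apply/subsetP=> e; rewrite inE => /andP[].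
    by apply/forall_inP=> e; rewrite inE => /andP[].
  + apply/andP; split; apply/forall_inP=> x /= xs.
      by rewrite !inE /= tournament_irr andbF.
    apply/forall_inP=> y ys; apply/implyP=> nxy.
    move: xs ys; rewrite !inE /= => -> ->.
    by rewrite (tourG x y) nxy; case: (G x y).
  + apply/existsP; exists s; rewrite us eqxx /=.
    apply/forallP=> i; apply/forallP=> j; apply/implyP=> ij.
    rewrite !inE /= !mem_tnth /=.
    have x0 := tnth s i; rewrite !(tnth_nth x0).
    by apply: (pairwiseP x0 Gs); rewrite ?inE ?size_tuple.
Qed.

Lemma num_transitiveE m :
  num_transitive m G = #|[set s : m.-tuple T | pairwise G s]|.
Proof.
rewrite /num_transitive transitive_subtournamentsE card_in_imset //.
move=> s t; rewrite !inE => Gs Gt [/setP est _].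
apply/val_inj/pairwise_tournament_inj => // x.
by have := est x; rewrite !inE.
Qed.

(** The number of arcs inside a set of vertices. *)
Lemma tournament_card_arcs (N : {set T}) :
  (\sum_(b in N) \sum_(c in N) G b c = 'C(#|N|, 2))%N.
Proof.
set S := (LHS in LHS = _).
(* Sum [G b c + G c b + (b == c) = 1] over all [b] and [c] in [N]. *)
have : (S + S + #|N| = #|N| * #|N|)%N.
  rewrite {2}/S exchange_big /= -sum1_card -!big_split /= sum1_card.
  rewrite -sum_nat_const; apply: eq_bigr => b bN.
  have -> : 1%N = (\sum_(c in N) (b == c))%N.
    rewrite (bigD1 b) //= eqxx big1 ?addn0 // => c /andP[_].
    by rewrite eq_sym => /negPf->.
  rewrite -!big_split /= -sum1_card; apply: eq_bigr => c _.
  by rewrite (tourG b c); case: eqVneq => [->|_]; rewrite ?tournament_irr //;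
    case: (G b c).
rewrite bin2; case: #|N| => [|n]; nia.
Qed.

(** Transitive triples are counted by their source. *)
Lemma num_transitive3 :
  (num_transitive 3 G = \sum_a 'C(#|[set b | G a b]|, 2))%N.
Proof.
rewrite num_transitiveE.
pose triple (p : T * (T * T)) := [tuple p.1; p.2.1; p.2.2].
have triple_inj : injective triple.
  by move=> [a [b c]] [a' [b' c']] /(congr1 val) [-> -> ->].
have triple_onto (s : 3.-tuple T) : exists p, s = triple p.
  case: s => -[|a [|b [|c [|]]]] // hs.
  by exists (a, (b, c)); apply/val_inj.
have -> : [set s : 3.-tuple T | pairwise G s] =
    triple @: [set p | [&& G p.1 p.2.1, G p.1 p.2.2 & G p.2.1 p.2.2]].
  apply/setP=> s; have [[a [b c]] ->] := triple_onto s.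
  by rewrite mem_imset // !inE /= !andbT andbA.
rewrite card_imset // -sum1_card.
under eq_bigl do rewrite inE.
rewrite big_mkcond -(pair_bigA _ (fun a q =>
  if [&& G a q.1, G a q.2 & G q.1 q.2] then 1 else 0)%N) /=.
apply: eq_bigr => a _; rewrite -tournament_card_arcs.
rewrite -(pair_bigA _ (fun b c =>
  if [&& G a b, G a c & G b c] then 1 else 0)%N) /= [RHS]big_mkcond.
apply: eq_bigr => b _; rewrite inE; case: (G a b); last by rewrite big1.
rewrite [RHS]big_mkcond; apply: eq_bigr => c _; rewrite inE.
by case: (G a c); case: (G b c).
Qed.

End Tournaments.

Section Paley.
Variables (F : finFieldType) (m : nat).
Hypotheses (cardF : #|F| = m.*2.+1) (odd_m : odd m).

(** Lagrange's theorem in the additive group gives #|F| = 0 in [F]; since #|F|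
    is odd, 2 = 0 is impossible. *)
Lemma m1_neq1 : -1 != 1 :> F.
Proof.
rewrite eq_sym -subr_eq0 opprK -mulr2n; apply/negP=> /eqP two0.
have : #|F|%:R = 0 :> F.
  by rewrite -cardsT -FinRing.Theory.zmodXgE expg_cardG ?inE.
rewrite cardF -addn1 natrD -mul2n natrM two0 mul0r add0r.
by move/eqP; rewrite oner_eq0.
Qed.

Lemma m1_expr : (-1) ^+ m = -1 :> F.
Proof. by rewrite -signr_odd odd_m expr1. Qed.

Lemma expr_half (x : F) : x != 0 -> (x ^+ m == 1) || (x ^+ m == -1).
Proof.
move=> nx0; rewrite -sqrf_eq1 -exprM muln2.
by have /eqP := expf_card x; rewrite cardF exprS -subr_eq0 -{3}[x]mulr1
  -mulrBr mulf_eq0 (negPf nx0) subr_eq0.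
Qed.

(** Euler's criterion. When [x ^+ m = 1], the power [x ^+ ((m + 1) / 2)] is a
    square root of [x]; the exponent is an integer because [m] is odd. *)
Lemma paleyE (a b : F) : paley a b = ((b - a) ^+ m == 1).
Proof.
rewrite /paley; move: (b - a) => x; apply/andP/idP => [[nx0]|/eqP xm1].
  case/existsP=> c /eqP ec; move: nx0; rewrite ec expf_eq0 /= => nc0.
  rewrite exprAC; case/orP: (expr_half nc0) => /eqP->.
    by rewrite expr1n.
  by rewrite sqrrN expr1n.
split.
  apply/eqP=> x0; move/eqP: xm1.
  by rewrite x0 expr0n eqn0Ngt odd_gt0 // eq_sym oner_eq0.
apply/existsP; exists (x ^+ m.+1./2).
by rewrite -exprM muln2 even_halfK /= ?odd_m // exprS xm1 mulr1.
Qed.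

Lemma paley_tournament : tournament (@paley F).
Proof.
move=> a b; rewrite !paleyE -(opprB b a) exprNn m1_expr mulN1r.
rewrite eqr_oppLR -[a == b]eq_sym -(subr_eq0 b a).
have [->|nx0] := eqVneq (b - a) 0 => /=.
  by rewrite expr0n eqn0Ngt odd_gt0 // eq_sym oppr_eq0 oner_eq0.
case/orP: (expr_half nx0) => /eqP->; rewrite eqxx ?m1_neq1 //.
by rewrite eq_sym (negPf m1_neq1).
Qed.

Lemma paley_outdegree (a : F) : #|[set b | paley a b]| = m.
Proof.
set N := [set b | _].
have inN : #|[set b | paley b a]| = #|N|.
  have refl_inj : injective (fun b : F => a + a - b).
    by move=> b c /addrI/oppr_inj.
  rewrite -(card_preimset N refl_inj); apply: eq_card => b.
  by rewrite !inE !paleyE; congr (_ ^+ _ == _); ring.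
have eC : [set b | paley b a] = ~: (a |: N).
  by apply/setP=> b; rewrite !inE paley_tournament negb_or eq_sym.
have aN : a \notin N by rewrite inE (tournament_irr paley_tournament).
by have := cardsC (a |: N); rewrite -eC inN cardsU1 aN cardF; lia.
Qed.

End Paley.

Theorem corollary2p7 (q : nat)
    (hpow : exists p k : nat, [/\ prime p, (0 < k)%N & q = (p ^ k)%N])
    (hmod : q = 3 %[mod 4])
    (F : finFieldType) (hF : #|F| = q) :
  (num_transitive 3 (@paley F))%:R
    = q%:R * (q%:R - 1) * (q%:R - 3) / 2 ^+ 3 :> rat.
Proof.
pose n := (q %/ 4)%N; pose m := n.*2.+1.
have eq : q = m.*2.+1 by rewrite /m /n; lia.
have cardF : #|F| = m.*2.+1 by rewrite hF.
have odd_m : odd m by rewrite /= odd_double.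
rewrite (num_transitive3 (paley_tournament cardF odd_m)).
under eq_bigr do rewrite (paley_outdegree cardF odd_m).
rewrite sum_nat_const cardF natrM eq.
have -> : 'C(m, 2) = (m * n)%N by rewrite bin2 /m /= -doubleMr doubleK.
have -> : (m * n)%:R = (2 * n%:R + 1) * n%:R :> rat.
  by rewrite natrM /m -natr1 -mul2n natrM.
have -> : m.*2.+1%:R = 4 * n%:R + 3 :> rat.
  by rewrite -[4]/(4%:R) -[3]/(3%:R) -natrM -natrD; congr _%:R; rewrite /m; lia.
by field.
Qed.
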